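(* For $n\ge2$, $$\widetilde A_{n-1}(t_0,\dots,t_{n-1})=\sum_{j=0}^{n-1}t_j\,A_{n-2}(t_{j+1},\dots,t_{n-1},t_0,\dots,t_{j-2}),$$ where the argument list of $A_{n-2}$ in the $j$-th term consists of the $n-2$ variables $t_{j+1},t_{j+2},\dots,t_{j+n-2}$ in this order, with subscripts read modulo $n$.
   Context: $S_n$ is the symmetric group on $\{1,\dots,n\}$, with permutations written in one-line form $w=w_1\cdots w_n$. It is the Weyl group $A_{n-1}$, with simple roots $\alpha_i=\varepsilon_{i+1}-\varepsilon_i$ ($1\le i<n$) and lowest root $\alpha_0=\varepsilon_1-\varepsilon_n$. The descent set of $w\in S_n$ is $\mathrm{Des}(w)=\{i\in\{1,\dots,n-1\}:w_i>w_{i+1}\}$, and the affine descent set is $\widetilde{\mathrm{Des}}(w)=\{i\in\{0,\dots,n-1\}:w_i>w_{i+1}\}$ with the convention $w_0=w_n$. The multivariate Eulerian and affine Eulerian polynomials are $$A_{n-1}(t_1,\dots,t_{n-1})=\sum_{w\in S_n}\prod_{i\in\mathrm{Des}(w)}t_i,\qquad \widetilde A_{n-1}(t_0,\dots,t_{n-1})=\sum_{w\in S_n}\prod_{i\in\widetilde{\mathrm{Des}}(w)}t_i$$ (so $A_0=1$, with no variables). *)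

(* Defs.v *)
From HB Require Import structures.
From mathcomp Require Import all_boot all_order all_algebra all_fingroup.
From mathcomp Require Import mpoly.

Set Implicit Arguments.
Unset Strict Implicit.
Unset Printing Implicit Defensive.

Import GRing.Theory.
Local Open Scope ring_scope.

(* S_(m+1) is 'S_m.+1, acting on {0, ..., m} instead of {1, ..., m+1}: the      *)
(* letter w_k of the one-line form is w evaluated at k - 1, with value lowered  *)
(* by 1.                                                                        *)

(* The element i : 'I_m stands for the position i + 1 in {1, ..., m}, at which  *)
(* w_(i+1) and w_(i+2) are compared.                                            *)
Definition Des (m : nat) (w : 'S_m.+1) : {set 'I_m} :=
  [set i : 'I_m | (w (lift ord0 i) < w (widen_ord (leqnSn m) i))%N].

(* The element i : 'I_m.+1 stands for the position i itself, at which w_i and   *)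
(* w_(i+1) are compared; ord_pred is cyclic, which gives w_0 = w_(m+1).         *)
Definition affDes (m : nat) (w : 'S_m.+1) : {set 'I_m.+1} :=
  [set i : 'I_m.+1 | (w i < w (ord_pred i))%N].

(* A_m(t_1, ..., t_m), where 'X_i is the variable t_(i+1).                      *)
Definition eulerian (m : nat) : {mpoly int[m]} :=
  \sum_(w : 'S_m.+1) \prod_(i in Des w) 'X_i.

(* The affine polynomial in t_0, ..., t_m, where 'X_i is the variable t_i.      *)
Definition affine_eulerian (m : nat) : {mpoly int[m.+1]} :=
  \sum_(w : 'S_m.+1) \prod_(i in affDes w) 'X_i.

(* Main.v *)
(** Cut the cyclic word of [w] just after its largest letter, and let [j] be the
    position that follows.  The position [j] is then an affine descent, the
    position of the largest letter is not one, and the remaining affine descents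
    of [w] are the descents of the word of length [n - 1] that starts at [j].
    The pair of [j] and this word determines [w]. *)
Require Import Defs.
From HB Require Import structures.
From mathcomp Require Import all_boot all_order all_algebra all_fingroup.
From mathcomp Require Import mpoly.

Set Implicit Arguments.
Unset Strict Implicit.
Unset Printing Implicit Defensive.

Import GRing.Theory.
Local Open Scope ring_scope.

(** Modulo [m.+1], [ord_max] is -1; being a translation, [ord_pred] commutes with shifts of the
    cut. *)
Lemma ord_predE (m : nat) (i : 'I_m.+1) : ord_pred i = i + ord_max.
Proof. by apply: val_inj; rewrite /= addnS. Qed.

Lemma ord_pred_add (m : nat) (i j : 'I_m.+1) : ord_pred (i + j) = i + ord_pred j.
Proof. by rewrite !ord_predE addrA. Qed.

Lemma ord_pred_lift0 (m : nat) (k : 'I_m) :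
  ord_pred (lift ord0 k) = widen_ord (leqnSn m) k.
Proof.
apply: val_inj; rewrite /= add0n modnDr.
by rewrite modn_small // ltnW // ltnS ltn_ord.
Qed.

(* The cyclic word that reads u followed by the largest letter from position j on;
   the product of permutations composes from left to right. *)
Definition insert_max (m : nat) (ju : 'I_m.+1 * 'S_m) : 'S_m.+1 :=
  (perm (addIr (- ju.1)) * lift_perm ord_max ord_max ju.2)%g.

Lemma insert_maxE (m : nat) (j s : 'I_m.+1) (u : 'S_m) :
  insert_max (j, u) (j + s) = lift_perm ord_max ord_max u s.
Proof. by rewrite permM; congr (lift_perm _ _ _ _); rewrite permE /= addrC addKr. Qed.

Lemma lift_max_widen (m : nat) (k : 'I_m) : widen_ord (leqnSn m) k = lift ord_max k.
Proof. exact/esym/val_inj/lift_max. Qed.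

Lemma insert_max_widen (m : nat) (j : 'I_m.+1) (u : 'S_m) (k : 'I_m) :
  insert_max (j, u) (j + widen_ord (leqnSn m) k) = u k :> nat.
Proof. by rewrite insert_maxE lift_max_widen lift_perm_lift lift_max. Qed.

Lemma insert_max_inj (m : nat) : injective (@insert_max m).
Proof.
move=> [j u] [j' u'] eq_w.
have ej : j = j'.
  (* The largest letter of [insert_max (j, u)] stands at [j + ord_max], so the word determines
     [j]. *)
  apply/(addIr ord_max)/(@perm_inj _ (insert_max (j, u))).
  by rewrite insert_maxE {1}eq_w insert_maxE !lift_perm_id.
rewrite -ej in eq_w *; congr pair; apply/permP=> k; apply: val_inj.
by rewrite /= -(insert_max_widen j u) eq_w insert_max_widen.
Qed.

Lemma insert_max_bij (m : nat) : bijective (@insert_max m).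
Proof.
apply: inj_card_bij; first exact: insert_max_inj.
by rewrite card_prod card_ord !card_Sn factS.
Qed.

Lemma affDes_insert_max (R : comNzRingType) (m : nat) (F : 'I_m.+2 -> R)
    (j : 'I_m.+2) (u : 'S_m.+1) :
  \prod_(i in affDes (insert_max (j, u))) F i =
  F j * \prod_(k in Des u) F (inZp (j + k.+1)).
Proof.
rewrite big_mkcond (reindex_inj (addrI j)) big_ord_recl; congr (_ * _).
  have pred0 : ord_pred 0 = ord_max :> 'I_m.+2 by rewrite ord_predE add0r.
  rewrite inE ord_pred_add pred0 !insert_maxE lift_perm_id addr0.
  (* With at least two letters, offset 0 is not [ord_max]: it carries a letter of [u], smaller than
     the largest letter just before it. *)
  have -> : ord0 = widen_ord (leqnSn m.+1) ord0 by apply: val_inj.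
  by rewrite lift_max_widen lift_perm_lift lift_max ltn_ord.
(* The last offset carries the largest letter, hence no descent and a factor 1; the offsets between
   compare consecutive letters of [u]. *)
rewrite big_ord_recr /= [X in _ * X]ifF ?mulr1.
  rewrite [RHS]big_mkcond; apply: eq_bigr => k _.
  rewrite !inE ord_pred_add ord_pred_lift0.
  have e1 : lift ord0 (widen_ord (leqnSn m) k) = widen_ord (leqnSn m.+1) (lift ord0 k).
    exact: val_inj.
  rewrite {1}e1 !insert_max_widen.
  by congr (if _ then F _ else _); apply: val_inj.
have -> : lift ord0 ord_max = ord_max :> 'I_m.+2 by apply: val_inj.
by rewrite inE ord_pred_add !insert_maxE lift_perm_id ltnNge -ltnS ltn_ord.
Qed.

(* inZp reduces modulo n.-1.+1, which is n. *)
Theorem proposition5p1 (n : nat) (hn : (2 <= n)%N) :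
  affine_eulerian n.-1 =
  \sum_(j < n.-1.+1)
    'X_j * (eulerian n.-2 \mPo [tuple 'X_(inZp (j + k.+1)) | k < n.-2]).
Proof.
case: n hn => [|[|m]] //= _; rewrite /affine_eulerian /eulerian.
rewrite (reindex (@insert_max m.+1)) /=; last exact/onW_bij/insert_max_bij.
rewrite -(pair_bigA _ (fun j u => \prod_(i in affDes (insert_max (j, u))) 'X_i)) /=.
apply: eq_bigr => j _; rewrite rmorph_sum mulr_sumr; apply: eq_bigr => u _.
rewrite affDes_insert_max rmorph_prod; congr (_ * _); apply: eq_bigr => k _.
by rewrite /= comp_mpolyXU -tnth_nth tnth_mktuple.
Qed.
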